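(* Let $\mathfrak q$ be a finite-dimensional Lie algebra over an algebraically closed field $\Bbbk$ of characteristic $0$ and $\vartheta\in\mathrm{Aut}(\mathfrak q)$ an automorphism of finite order $m$. If $\mathfrak q^*_{\mathsf{reg}}\cap\mathfrak q_0^*\neq\varnothing$, then $\mathcal Z(\widehat{\mathfrak q}^\vartheta,[0])$ is a Poisson-commutative subalgebra of $S(\widehat{\mathfrak q}^\vartheta_+)$.
   Context: Fix a primitive $m$-th root of unity $\zeta$ and let $\mathfrak q_i$ ($0\le i\le m-1$) be the $\zeta^i$-eigenspace of $\vartheta$. For $k\in\mathbb Z$ let $\bar k\in\{0,\dots,m-1\}$ be its residue mod $m$. Extend $\vartheta$ to an automorphism $\Theta$ of the loop algebra $\mathfrak q[t,t^{-1}]=\mathfrak q\otimes\Bbbk[t,t^{-1}]$ by $\Theta(\xi t^k)=\zeta^k\vartheta(\xi)t^k$; the twisted loop algebra is $\widehat{\mathfrak q}^\vartheta=\mathfrak q[t,t^{-1}]^\Theta=\bigoplus_{k\in\mathbb Z}\mathfrak q_{\bar k}t^{-k}$. Put $\widehat{\mathfrak q}^\vartheta_+=\widehat{\mathfrak q}^\vartheta\cap\mathfrak q[t]$ and $\mathfrak q[t^{-1}]^\vartheta=\widehat{\mathfrak q}^\vartheta\cap\mathfrak q[t^{-1}]$. Identifying $\widehat{\mathfrak q}^\vartheta_+$ with the quotient $\widehat{\mathfrak q}^\vartheta/(t^{-1}\mathfrak q[t^{-1}])^\Theta$ gives an action of $\mathfrak q[t^{-1}]^\vartheta$ on $S(\widehat{\mathfrak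 q}^\vartheta_+)$, and $\mathcal Z(\widehat{\mathfrak q}^\vartheta,[0])=S(\widehat{\mathfrak q}^\vartheta_+)^{\mathfrak q[t^{-1}]^\vartheta}$ is the subalgebra of invariants; equivalently, $Y\in S(\widehat{\mathfrak q}^\vartheta_+)$ lies in it iff $\{x,Y\}\in (t^{-1}\mathfrak q[t^{-1}])^\Theta\, S(\widehat{\mathfrak q}^\vartheta)$ for all $x\in\mathfrak q[t^{-1}]^\vartheta$. Here $\{\,,\}$ is the Lie–Poisson bracket on symmetric algebras ($\{x,y\}=[x,y]$ for Lie algebra elements), and Poisson-commutative means $\{Y_1,Y_2\}=0$ for all $Y_1,Y_2$ in the subalgebra. $\mathfrak q_0^*$ is the annihilator of $\bigoplus_{i\ge1}\mathfrak q_i$ in $\mathfrak q^*$; $\mathfrak q^*_{\mathsf{reg}}$ is the set of $\xi\in\mathfrak q^*$ whose stabiliser $\mathfrak q^\xi$ has minimal dimension (equal to $\mathrm{ind}\,\mathfrak q$). *)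

(* Defs.v *)
From HB Require Import structures.
From mathcomp Require Import all_boot all_order all_algebra.
From mathcomp Require Import finmap.
From mathcomp Require Import monalg.

Set Implicit Arguments.
Unset Strict Implicit.
Unset Printing Implicit Defensive.

Import GRing.Theory.
Local Open Scope ring_scope.

Section Defs.
Variable K : fieldType.
Variable n : nat.

(** The finite-dimensional Lie algebra q is K^n (row vectors), with
    bracket given by structure constants [c i j = [e_i, e_j]]. *)
Definition lie_br (c : 'I_n -> 'I_n -> 'rV[K]_n) (x y : 'rV[K]_n) : 'rV[K]_n :=
  \sum_(i < n) \sum_(j < n) (x 0 i * y 0 j) *: c i j.

Definition is_lie_algebra (c : 'I_n -> 'I_n -> 'rV[K]_n) : Prop :=
  (forall x, lie_br c x x = 0) /\
  (forall x y z, lie_br c x (lie_br c y z) + lie_br c y (lie_br c z x)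
                 + lie_br c z (lie_br c x y) = 0).

Definition is_lie_aut (c : 'I_n -> 'I_n -> 'rV[K]_n) (Th : 'M[K]_n) : Prop :=
  Th \in unitmx /\
  (forall x y, lie_br c (x *m Th) (y *m Th) = lie_br c x y *m Th).

Definition has_order (Th : 'M[K]_n) (m : nat) : Prop :=
  (0 < m)%N /\ Th ^+ m = 1%:M /\ (forall d, (0 < d < m)%N -> Th ^+ d != 1%:M).

Definition in_eig (Th : 'M[K]_n) (z : K) (i : nat) (x : 'rV[K]_n) : Prop :=
  x *m Th = (z ^+ i) *: x.

Definition bar (m : nat) (k : int) : nat := absz (k %% (m%:Z))%Z.

(** linear forms on q are row vectors, paired with q by the standard pairing *)
Definition pairing (f x : 'rV[K]_n) : K := \sum_(i < n) f 0 i * x 0 i.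

(** f lies in q_0^* = annihilator of q_1 + ... + q_{m-1} *)
Definition in_q0star (Th : 'M[K]_n) (z : K) (m : nat) (f : 'rV[K]_n) : Prop :=
  forall xs : nat -> 'rV[K]_n,
    (forall i, (1 <= i < m)%N -> in_eig Th z i (xs i)) ->
    pairing f (\sum_(1 <= i < m) xs i) = 0.

(** matrix M_f with (M_f)_{ij} = f([e_i, e_j]); the stabiliser
    q^f = {x | f([x, y]) = 0 for all y} is the row kernel of M_f *)
Definition coad_mx (c : 'I_n -> 'I_n -> 'rV[K]_n) (f : 'rV[K]_n) : 'M[K]_n :=
  \matrix_(i < n, j < n) pairing f (lie_br c (delta_mx 0 i) (delta_mx 0 j)).

Definition stab_dim (c : 'I_n -> 'I_n -> 'rV[K]_n) (f : 'rV[K]_n) : nat :=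
  \rank (kermx (coad_mx c f)).

Definition is_regular (c : 'I_n -> 'I_n -> 'rV[K]_n) (f : 'rV[K]_n) : Prop :=
  forall g : 'rV[K]_n, (stab_dim c f <= stab_dim c g)%N.

(** The symmetric algebra S(q[t,t^-1]) as the polynomial algebra in the
    variables X_(i,j) = e_i t^j, i < n, j in Z. *)
Definition Var : choiceType := ('I_n * int)%type.
Definition SP := {malg K[cmonom Var]}.

Definition X (a : Var) : SP := << ucm a >>.

(** the loop algebra element x t^j, as a degree-one element of SP *)
Definition lt (x : 'rV[K]_n) (j : int) : SP := \sum_(i < n) x 0 i *: X (i, j).

Definition xbr (c : 'I_n -> 'I_n -> 'rV[K]_n) (a b : Var) : SP :=
  lt (lie_br c (delta_mx 0 a.1) (delta_mx 0 b.1)) (a.2 + b.2).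

Definition vars (g : SP) : seq Var :=
  undup (flatten [seq (finsupp (cmonom_val mo) : seq Var) | mo <- msupp g]).

Definition pderiv (a : Var) (g : SP) : SP :=
  \sum_(mo <- msupp g) (g@_mo * (cmonom_val mo a)%:R) *: << divcm mo (ucm a) >>.

(** Lie-Poisson bracket on S(q[t,t^-1]): the biderivation extending the
    Lie bracket on generators. *)
Definition pbr (c : 'I_n -> 'I_n -> 'rV[K]_n) (g h : SP) : SP :=
  \sum_(a <- vars g) \sum_(b <- vars h) pderiv a g * pderiv b h * xbr c a b.

(** subalgebra of SP generated by a set G (so S(V) for a subspace V of the
    loop algebra is the subalgebra generated by V) *)
Inductive gen_alg (G : SP -> Prop) : SP -> Prop :=
| ga_gen y : G y -> gen_alg G y
| ga_one : gen_alg G 1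
| ga_scale (a : K) y : gen_alg G y -> gen_alg G (a *: y)
| ga_add y w : gen_alg G y -> gen_alg G w -> gen_alg G (y + w)
| ga_mul y w : gen_alg G y -> gen_alg G w -> gen_alg G (y * w).

Inductive in_ideal (R A : SP -> Prop) : SP -> Prop :=
| id_gen a r : A a -> R r -> in_ideal R A (a * r)
| id_zero : in_ideal R A 0
| id_add y w : in_ideal R A y -> in_ideal R A w -> in_ideal R A (y + w).

(** homogeneous elements x t^j of the twisted loop algebra
    (x t^j is Theta-fixed iff x lies in q_{bar(-j)}) *)
Definition twisted_hom (Th : 'M[K]_n) (z : K) (m : nat) (y : SP) (P : int -> Prop) : Prop :=
  exists (j : int) (x : 'rV[K]_n), P j /\ in_eig Th z (bar m (- j)) x /\ y = lt x j.

Definition gen_all Th z m (y : SP) := twisted_hom Th z m y (fun _ => True).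
Definition gen_plus Th z m (y : SP) := twisted_hom Th z m y (fun j => 0 <= j).
Definition gen_neg Th z m (y : SP) := twisted_hom Th z m y (fun j => j < 0).

Definition S_plus Th z m := gen_alg (gen_plus Th z m).
Definition S_all Th z m := gen_alg (gen_all Th z m).

Definition neg_loop_elt (xs : seq 'rV[K]_n) : SP :=
  \sum_(k < size xs) lt xs`_k (- (k%:Z)).
Definition is_neg_twisted Th z m (xs : seq 'rV[K]_n) : Prop :=
  forall k, (k < size xs)%N -> in_eig Th z (bar m k%:Z) xs`_k.

Definition Zcal c Th z m (Y : SP) : Prop :=
  S_plus Th z m Y /\
  forall xs, is_neg_twisted Th z m xs ->
    in_ideal (S_all Th z m) (gen_neg Th z m) (pbr c (neg_loop_elt xs) Y).

Definition is_subalgebra (P : SP -> Prop) : Prop :=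
  [/\ P 1, (forall (a : K) y, P y -> P (a *: y)),
      (forall y w, P y -> P w -> P (y + w)) & (forall y w, P y -> P w -> P (y * w))].

End Defs.

(* Main.v *)
(** Both sides of [{Y1, Y2} = 0] are polynomials, so it is enough to evaluate at a
    linear form [xi] on the twisted loop algebra that vanishes on negative powers
    of [t], and by density [xi_0] (its part on [q_0]) may be assumed regular.
    Put [s = 1/t], [Xi(s) = sum_l xi_l s^l], and let [V_i(t)] be the differential
    of [Y_i] at [xi]. Membership in the invariants says that the covector
    [Xi(s)([V_i, .])] lies in [s K[s]^n], and [{Y1, Y2}(xi)] is the constant term
    of [Xi(s)([V_1, V_2])]. As the rank of the skew form [Xi(s)([., .])] at [s = 0]
    is already the generic one, an element of [s K[[s]]^n] in its image has a
    preimage in [s K[[s]]^n]; hence [Xi(s)([V_1, V_2])] is divisible by [s^2], and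
    its constant term vanishes. The Jacobi identity plays no role. *)

Require Import Defs.
From HB Require Import structures.
From mathcomp Require Import all_boot all_order all_algebra.
From mathcomp Require Import finmap.
From mathcomp Require Import monalg.
From mathcomp Require Import zify.

Set Implicit Arguments.
Unset Strict Implicit.
Unset Printing Implicit Defensive.

Import GRing.Theory.
Local Open Scope ring_scope.

(** * Derivations and evaluation on the symmetric algebra *)

Lemma malg_ind (G : nzRingType) (M : choiceType) (P : {malg G[M]} -> Prop) :
  P 0 -> (forall g h, P g -> P h -> P (g + h)) ->
  (forall c k, P << c *g k >>) -> forall g, P g.
Proof.
move=> P0 PD PU g; rewrite [g]monalgE.
by elim/big_ind: _ => // k _; apply: PU.
Qed.

Lemma scale_malgU (R : nzRingType) (M : choiceType) (c : R) (k : M) :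
  c *: << k >> = << c *g k >>.
Proof. by apply/malgP=> j; rewrite mcoeffZ !mcoeffU mulrnAr mulr1. Qed.

Lemma malgUM (R : nzRingType) (M : monomType) (c d : R) (k l : M) :
  << c *g k >> * << d *g l >> = << (c * d) *g mmul k l >>.
Proof. by rewrite malgM_def fgmulUU. Qed.

(* On monomials [d] is a partial derivative: [w] is the exponent of the variable
   and [s] divides by the variable (with a junk value when [w k = 0]). *)
Lemma malg_leibniz (R : comNzRingType) (M : conomType)
    (d : {malg R[M]} -> {malg R[M]}) (w : M -> nat) (s : M -> M) :
  {morph d : g h / g + h} ->
  (forall c k, d << c *g k >> = << (c * (w k)%:R) *g s k >>) ->
  (forall k l, w (mmul k l) = (w k + w l)%N) ->
  (forall k l, (0 < w k)%N -> s (mmul k l) = mmul (s k) l) ->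
  forall g h, d (g * h) = d g * h + g * d h.
Proof.
move=> dD dU wM sM g h.
have d0 : d 0 = 0 by apply: (addrI (d 0)); rewrite -dD !addr0.
elim/malg_ind: g => [|g1 g2 H1 H2|k m1]; first by rewrite mul0r d0 !mul0r addr0.
  by rewrite mulrDl !dD H1 H2 !mulrDl addrACA.
elim/malg_ind: h => [|g1 g2 H1 H2|l m2]; first by rewrite mulr0 d0 !mulr0 addr0.
  by rewrite mulrDr !dD H1 H2 !mulrDr addrACA.
rewrite malgUM !dU !malgUM wM natrD mulrDr monalgUD; congr (_ + _).
  case: (posnP (w m1)) => [->|w1]; first by rewrite !mulr0 mul0r !monalgU0.
  by rewrite sM // mulrAC.
case: (posnP (w m2)) => [->|w2]; first by rewrite !mulr0 !monalgU0.
by rewrite mulmC sM // [mmul m1 _]mulmC mulrA.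
Qed.

Lemma mul3_eq0r (R : nzRingType) (x y z : R) : y = 0 -> x * y * z = 0.
Proof. by move=> ->; rewrite mulr0 mul0r. Qed.

Lemma big_seq_supp (V : nmodType) (I : eqType) (r s : seq I) (F : I -> V) :
  uniq r -> uniq s -> (forall i, i \notin r -> F i = 0) ->
  (forall i, i \notin s -> F i = 0) ->
  \sum_(i <- r) F i = \sum_(i <- s) F i.
Proof.
move=> ur us Fr Fs; rewrite [LHS](bigID (mem s)) [RHS](bigID (mem r)) /=.
rewrite [X in _ + X]big1 // [X in _ = _ + X]big1 // !addr0.
rewrite -[LHS]big_filter -[RHS]big_filter; apply: perm_big.
by apply: uniq_perm => [||i]; rewrite ?filter_uniq // !mem_filter andbC.
Qed.

(** Lets the lists [vars g] and [vars h] in [pbr] be replaced by any duplicate-free lists outside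
    which the derivatives, or their values at a point, vanish. *)
Lemma bilinear_supp (R : nzRingType) (I : eqType) (p q : I -> R)
    (x : I -> I -> R) (r r' s s' : seq I) :
  uniq r -> uniq r' -> uniq s -> uniq s' ->
  (forall i, i \notin r -> p i = 0) -> (forall i, i \notin s -> p i = 0) ->
  (forall i, i \notin r' -> q i = 0) -> (forall i, i \notin s' -> q i = 0) ->
  \sum_(i <- r) \sum_(j <- r') p i * q j * x i j =
  \sum_(i <- s) \sum_(j <- s') p i * q j * x i j.
Proof.
move=> ur ur' us us' pr ps qr qs.
rewrite (big_seq_supp ur us) => [|i /pr ->|i /ps ->].
- apply: eq_bigr => i _; apply: big_seq_supp => // j; [move/qr | move/qs] => ->.
    by rewrite mulr0 mul0r.
  by rewrite mulr0 mul0r.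
- by rewrite big1 // => j _; rewrite !mul0r.
by rewrite big1 // => j _; rewrite !mul0r.
Qed.

Section Pderiv.
Variables (K : fieldType) (n : nat).
Implicit Types (g h : SP K n) (a b : Var n) (mo : cmonom (Var n)).

Lemma pderivEw (d : {fset cmonom (Var n)}) a g : (msupp g `<=` d)%fset ->
  pderiv a g =
  \sum_(mo <- d) (g@_mo * (cmonom_val mo a)%:R) *: << divcm mo (ucm a) >>.
Proof.
move=> sd; rewrite /pderiv; apply: big_fset_incl => // mo _ /mcoeff_outdom ->.
by rewrite mul0r scale0r.
Qed.

Lemma pderivD a : {morph @pderiv K n a : g h / g + h}.
Proof.
move=> g h.
rewrite (pderivEw a (msuppD_le g h)) (pderivEw a (fsubsetUl (msupp g) (msupp h))).
rewrite (pderivEw a (fsubsetUr (msupp g) (msupp h))) -big_split /=.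
by apply: eq_bigr => mo _; rewrite mcoeffD mulrDl scalerDl.
Qed.

Lemma pderivZ a (k : K) g : pderiv a (k *: g) = k *: pderiv a g.
Proof.
rewrite (pderivEw a (msuppZ_le k g)) /pderiv scaler_sumr.
by apply: eq_bigr => mo _; rewrite mcoeffZ scalerA mulrA.
Qed.

Lemma pderiv0 a : pderiv a (0 : SP K n) = 0.
Proof. by rewrite /pderiv msupp0 big_seq_fset0. Qed.

Lemma pderivU a (k : K) (mo : cmonom (Var n)) :
  pderiv a << k *g mo >> = << (k * (mo a)%:R) *g divcm mo (ucm a) >>.
Proof.
rewrite (pderivEw a msuppU_le) big_seq_fset1 mcoeffUU.
exact: scale_malgU.
Qed.

Lemma pderivM a g h : pderiv a (g * h) = pderiv a g * h + g * pderiv a h.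
Proof.
move: g h; apply: (@malg_leibniz _ _ _ (fun mo => cmonom_val mo a)
  (fun mo => divcm mo (ucm a))).
- exact: pderivD.
- exact: pderivU.
- by move=> k l; rewrite cmM.
(* Exponents are subtracted in [nat]; by [k0] the subtraction at [a] is not truncated. *)
move=> k l k0; apply/eqP/cmP => b; rewrite !(divcmE, cmM, cmU).
by case: eqP => [<-|_]; rewrite ?subn0 // addnBAC.
Qed.

Lemma pderiv_notin_vars a g : a \notin vars g -> pderiv a g = 0.
Proof.
move=> ag; rewrite /pderiv big_seq big1 // => mo mog.
have -> : cmonom_val mo a = 0%N; last by rewrite mulr0 scale0r.
apply/eqP; rewrite cmE_eq0; apply: contra ag => ag.
by rewrite mem_undup; apply/flatten_mapP; exists mo.
Qed.

Lemma vars_uniq g : uniq (vars g).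
Proof. exact: undup_uniq. Qed.

Lemma pbrEw (s1 s2 : seq (Var n)) c g h :
  uniq s1 -> uniq s2 -> {subset vars g <= s1} -> {subset vars h <= s2} ->
  pbr c g h =
  \sum_(a <- s1) \sum_(b <- s2) pderiv a g * pderiv b h * xbr c a b.
Proof.
move=> u1 u2 v1 v2.
apply: (@bilinear_supp _ _ (fun a => pderiv a g) (fun b => pderiv b h) (xbr c)
  _ _ _ _ (vars_uniq g) (vars_uniq h) u1 u2) => [a|a as1|b|b bs2].
- exact: pderiv_notin_vars.
- by apply: pderiv_notin_vars; apply: contra as1 => /v1.
- exact: pderiv_notin_vars.
by apply: pderiv_notin_vars; apply: contra bs2 => /v2.
Qed.

End Pderiv.

Section Eval.
Variables (K : fieldType) (n : nat) (R : comNzRingType).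
Variables (f : {rmorphism K -> R}) (v : Var n -> R).
Implicit Types (g h : SP K n) (a b : Var n) (mo : cmonom (Var n)).

Definition monom_eval (mo : cmonom (Var n)) : R :=
  \prod_(a <- finsupp mo) v a ^+ mo a.

Lemma monom_evalEw (d : {fset Var n}) (mo : cmonom (Var n)) :
  (finsupp mo `<=` d)%fset ->
  monom_eval mo = \prod_(a <- d) v a ^+ mo a.
Proof.
move=> sd; apply: big_fset_incl => // a _.
by rewrite -cmE_eq0 => /eqP ->; rewrite expr0.
Qed.

Lemma monom_eval_is_multiplicative : mmorphism monom_eval.
Proof.
split=> [m1 m2|]; last by rewrite /monom_eval mdom1 big_seq_fset0.
have s1 : (finsupp m1 `<=` finsupp (mmul m1 m2))%fset by rewrite mdomD fsubsetUl.
have s2 : (finsupp m2 `<=` finsupp (mmul m1 m2))%fset by rewrite mdomD fsubsetUr.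
rewrite (monom_evalEw s1) (monom_evalEw s2) /monom_eval -big_split /=.
by apply: eq_bigr => a _; rewrite cmM exprD.
Qed.

HB.instance Definition _ := isMultiplicative.Build (cmonom (Var n)) R monom_eval
  monom_eval_is_multiplicative.

(** Values lie in a ring [R] over [K]: [f := idfun] evaluates at a point, [f := polyC] along a
    family of points depending polynomially on a parameter. *)
Definition ev (g : SP K n) : R := mmap f monom_eval g.

Lemma evD g h : ev (g + h) = ev g + ev h.
Proof. exact: mmapD. Qed.

Lemma ev0 : ev 0 = 0.
Proof. exact: mmap0. Qed.

Lemma evM g h : ev (g * h) = ev g * ev h.
Proof. exact: (mmap_is_multiplicative (h := monom_eval)).1. Qed.

Lemma ev1 : ev 1 = 1.
Proof. exact: (mmap1 (h := monom_eval)). Qed.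

Lemma evZ k g : ev (k *: g) = f k * ev g.
Proof. exact: (mmapZ (h := monom_eval)). Qed.

Lemma evU k mo : ev << k *g mo >> = f k * monom_eval mo.
Proof. exact: mmapU. Qed.

Lemma ev_sum (I : Type) (r : seq I) (F : I -> SP K n) :
  ev (\sum_(i <- r) F i) = \sum_(i <- r) ev (F i).
Proof. by elim/big_rec2: _ => [|i y1 y2 _ <-]; rewrite ?ev0 ?evD. Qed.

Lemma evX a : ev (X K a) = v a.
Proof. by rewrite /X evU rmorph1 mul1r /monom_eval mdomU big_seq_fset1 cmUU expr1. Qed.

Lemma ev_lt (x : 'rV[K]_n) j : ev (lt x j) = \sum_i f (x 0 i) * v (i, j).
Proof. by rewrite ev_sum; apply: eq_bigr => i _; rewrite evZ evX. Qed.

Lemma ev_pderivX a b : ev (pderiv a (X K b)) = (a == b)%:R.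
Proof.
rewrite /X pderivU evU cmU eq_sym; case: eqP => [->|_]; last first.
  by rewrite mulr0 rmorph0 mul0r.
have -> : divcm (ucm b) (ucm b) = mone.
  by apply/eqP/cmP => j; rewrite divcmE subnn cm1.
by rewrite mulr1 rmorph1 mul1r /monom_eval mdom1 big_seq_fset0.
Qed.

Lemma ev_pderivD a g h : ev (pderiv a (g + h)) = ev (pderiv a g) + ev (pderiv a h).
Proof. by rewrite pderivD evD. Qed.

Lemma ev_pderiv_sum a (I : Type) (r : seq I) (F : I -> SP K n) :
  ev (pderiv a (\sum_(i <- r) F i)) = \sum_(i <- r) ev (pderiv a (F i)).
Proof.
elim/big_rec2: _ => [|i y1 y2 _ <-]; first by rewrite pderiv0 ev0.
exact: ev_pderivD.
Qed.

Lemma ev_pderiv_lt i k (x : 'rV[K]_n) j :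
  ev (pderiv (i, k) (lt x j)) = f (x 0 i) * (k == j)%:R.
Proof.
rewrite ev_pderiv_sum (bigD1 i) //= big1 => [|l nli].
  by rewrite pderivZ evZ ev_pderivX xpair_eqE eqxx addr0.
by rewrite pderivZ evZ ev_pderivX xpair_eqE eq_sym (negPf nli) mulr0.
Qed.

Lemma ev_pderivM a g h :
  ev (pderiv a (g * h)) = ev (pderiv a g) * ev h + ev g * ev (pderiv a h).
Proof.
rewrite pderivM; apply: etrans (evD _ _) _.
by congr (_ + _); apply: evM.
Qed.

Lemma ev_pderiv1 a : ev (pderiv a 1) = 0.
Proof.
have e : pderiv a (1 : SP K n) = pderiv a << 1 *g mone >> by [].
by rewrite e pderivU evU cm1 mulr0 rmorph0 mul0r.
Qed.

End Eval.

(** * Polynomials are determined by their values *)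

Lemma pchar0_exp2I (K : fieldType) : [pchar K] =i pred0 ->
  injective (fun i : nat => 2%:R ^+ i : K).
Proof.
move=> /pcharf0P ch i j; wlog ij : i j / (i <= j)%N => [H|].
  by case/orP: (leq_total i j) => /H{}H e; [apply: H | apply/esym/H].
rewrite -!natrX => /eqP; rewrite eq_sym -subr_eq0 -natrB ?leq_exp2l // ch.
rewrite subn_eq0 leq_exp2l // => ji.
by apply/eqP; rewrite eqn_leq ij ji.
Qed.

(* As in Artin's independence of characters: comparing the relation with the one
   obtained by rescaling a single variable by 2 eliminates one monomial. *)
Lemma monom_eval_indep (K : fieldType) (n : nat) (s : seq (cmonom (Var n)))
    (c : cmonom (Var n) -> K) : [pchar K] =i pred0 -> uniq s ->
  (forall v, \sum_(k <- s) c k * monom_eval v k = 0) ->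
  forall k, k \in s -> c k = 0.
Proof.
move=> ch; elim: s c => //= m0 s IHs c /andP[m0s us] H.
have cs k : k \in s -> c k = 0.
  move=> ks; apply/eqP/negPn/negP => ck; case/negP: m0s.
  suff <- : k = m0 by [].
  apply/eqP/cmP => a; apply: (pchar0_exp2I ch).
  suff /eqP : (2%:R ^+ k a - 2%:R ^+ m0 a) * c k = 0.
    by rewrite mulf_eq0 (negPf ck) orbF subr_eq0 => /eqP.
  (* The shorter relation has the coefficients [c k] multiplied by [2^(k a) - 2^(m0 a)]; its
     triviality makes the exponents of [k] and [m0] at [a] agree when [c k] is nonzero. *)
  apply: (IHs (fun k => (2%:R ^+ k a - 2%:R ^+ m0 a) * c k) us _ k ks) => v.
  pose v' b := if b == a then 2%:R * v b else v b.
  have v'E k' : monom_eval v' k' = 2%:R ^+ k' a * monom_eval v k'.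
    have s1 : (finsupp k' `<=` a |` finsupp k')%fset by rewrite fsubsetU1.
    rewrite !(monom_evalEw _ s1) [LHS](big_fsetD1 a) ?fset1U1 //=.
    rewrite [in RHS](big_fsetD1 a) ?fset1U1 //= /v' eqxx exprMn -!mulrA.
    congr (_ * (_ * _)).
    by apply: eq_big_seq => b; rewrite in_fsetD1 => /andP[/negPf->].
  have := H v'; rewrite big_cons v'E => /eqP; rewrite addrC addr_eq0 => /eqP Hv'.
  have := H v; rewrite big_cons => /eqP; rewrite addrC addr_eq0 => /eqP Hv.
  transitivity (\sum_(k <- s) c k * monom_eval v' k
                - 2%:R ^+ m0 a * \sum_(k <- s) c k * monom_eval v k).
    rewrite mulr_sumr -sumrB; apply: eq_bigr => k' _.
    by rewrite v'E [in RHS]mulrCA -mulrBl mulrA.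
  by rewrite Hv' Hv mulrN opprK mulrCA mulrA addNr.
move=> k; rewrite inE => /orP[/eqP -> | /cs //].
(* Every monomial is 1 at the all-ones point, where only the coefficient of [m0] is left. *)
have := H (fun=> 1); rewrite big_cons big_seq big1 ?addr0 => [|k' /cs ->].
  rewrite /monom_eval big1 ?mulr1 // => a _; exact: expr1n.
by rewrite mul0r.
Qed.

Lemma ev_inj0 (K : fieldType) (n : nat) (g : SP K n) : [pchar K] =i pred0 ->
  (forall v, ev idfun v g = 0) -> g = 0.
Proof.
move=> ch g0; apply/malgP => k; rewrite mcoeff0.
case: (boolP (k \in msupp g)) => [kg|/mcoeff_outdom //].
exact: (@monom_eval_indep K n (msupp g) (fun k => g@_k) ch (fset_uniq _) g0 k kg).
Qed.

(** * Skew matrix polynomials of constant rank *)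

(** A maximal free set of rows forms a matrix of full row rank; a maximal free set of its columns
    then cuts out the minor. *)
Lemma invertible_minor_exists (F : fieldType) (m n : nat) (A : 'M[F]_(m, n)) :
  exists (f : 'I_(\rank A) -> 'I_m) (g : 'I_(\rank A) -> 'I_n),
    mxsub f g A \in unitmx.
Proof.
pose f := maxrankfun A; pose R := rowsub f A.
have RT : row_full R^T.
  by rewrite /row_full mxrank_tr; have := maxrowsub_free A; rewrite /row_free.
exists f, (fullrankfun RT).
have := fullrowsub_unit RT; rewrite -unitmx_tr; congr (_ \in unitmx).
by apply/matrixP => i j; rewrite !mxE.
Qed.

(** The rows chosen by [f] have rank at least [r], hence span the row space of [A], and
    [A = C *m rowsub f A] for some [C]. Restricting to the columns [g] determines [C]. *)
Lemma minor_factorization (F : fieldType) (m n r : nat) (A : 'M[F]_(m, n))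
    (f : 'I_r -> 'I_m) (g : 'I_r -> 'I_n) :
  (\rank A <= r)%N -> mxsub f g A \in unitmx ->
  A = colsub g A *m invmx (mxsub f g A) *m rowsub f A.
Proof.
move=> rA uB; have BE : mxsub f g A = colsub g (rowsub f A).
  by apply/matrixP => i j; rewrite !mxE.
have sRA : (rowsub f A <= A)%MS.
  by apply/row_subP => i; rewrite row_rowsub row_sub.
have rR : (r <= \rank (rowsub f A))%N.
  rewrite -{1}(eqP (_ : row_free (mxsub f g A))) ?row_free_unit // BE.
  by rewrite -[rowsub f A]mulmx1 -mulmx_colsub mulmx1 mxrankM_maxl.
have /submxP[C AE] : (A <= rowsub f A)%MS.
  have [_ <-] := mxrank_leqif_sup sRA.
  by rewrite eqn_leq (mxrankS sRA) (leq_trans rA rR).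
have gA : colsub g A = C *m mxsub f g A.
  by rewrite BE mulmx_colsub -AE.
by rewrite gA mulmxK // -AE.
Qed.

Lemma poly_eq0_closed (K : closedFieldType) (p : {poly K}) :
  (forall a, p.[a] = 0) -> p = 0.
Proof.
move=> p0; apply/eqP/negPn/negP => /closed_nonrootP[x].
by rewrite /root p0 eqxx.
Qed.

(** This is [minor_factorization] with denominators cleared, verified at every point [a]. The
    difference of both sides is first multiplied by the determinant, which makes the points where
    the minor degenerates harmless. *)
Lemma poly_minor_factorization (K : closedFieldType) (m n r : nat)
    (A : 'M[{poly K}]_(m, n)) (f : 'I_r -> 'I_m) (g : 'I_r -> 'I_n) :
  \det (mxsub f g A) != 0 ->
  (forall a, \rank (map_mx (horner_eval a) A) <= r)%N ->
  \det (mxsub f g A) *: A = colsub g A *m \adj (mxsub f g A) *m rowsub f A.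
Proof.
set B := mxsub f g A; set d := \det B => d0 rA; apply/eqP; rewrite -subr_eq0.
set E := (X in X == 0); apply/eqP/matrixP => i j; rewrite [RHS]mxE.
suff : d * E i j = 0 by move/eqP; rewrite mulf_eq0 (negPf d0) => /eqP.
apply: poly_eq0_closed => a; rewrite hornerM.
have [-> | da] := eqVneq d.[a] 0; first by rewrite mul0r.
pose Aa := map_mx (horner_eval a) A.
have dE : d.[a] = \det (mxsub f g Aa).
  by rewrite -[LHS]/(horner_eval a d) -det_map_mx map_mxsub.
have uBa : mxsub f g Aa \in unitmx by rewrite unitmxE -dE unitfE.
suff -> : (E i j).[a] = 0 by rewrite mulr0.
suff -> : (E i j).[a] = map_mx (horner_eval a) E i j.
  rewrite /E map_mxB map_mxZ !map_mxM map_mx_adj !map_mxsub -/Aa.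
  set x := (X in X *: Aa); have -> : x = \det (mxsub f g Aa) := dE.
  rewrite [X in _ *: X](minor_factorization (rA a : \rank Aa <= r)%N uBa) /invmx uBa.
  rewrite -scalemxAr -scalemxAl scalerA.
  by rewrite divff -?dE // scale1r subrr mxE.
by rewrite [RHS]mxE.
Qed.

Lemma dvdp_big_sum (F : fieldType) (I : finType) (q : {poly F})
    (p : I -> {poly F}) :
  (forall i, q %| p i) -> q %| \sum_i p i.
Proof. by move=> qp; elim/big_ind: _ => // x y; apply: dvdp_add.
Qed.

(* The factorization through the invertible minor writes [d * (V A W^T)] as
   [(V A)_g adj(B) (A W^T)_f], where both outer factors are divisible by ['X^N]. *)
Lemma dvdp_skew_form (K : closedFieldType) (n r N : nat)
    (A : 'M[{poly K}]_n) (f g : 'I_r -> 'I_n) (V W : 'rV[{poly K}]_n) :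
  A^T = - A -> (\det (mxsub f g A)).[0] != 0 ->
  (forall a, \rank (map_mx (horner_eval a) A) <= r)%N ->
  (forall j, 'X^N %| (V *m A) 0 j) -> (forall j, 'X^N %| (W *m A) 0 j) ->
  'X^(N + N) %| (V *m A *m W^T) 0 0.
Proof.
move=> AT d0 rA VA WA; set d := \det _ in d0.
(* Since [d] is nonzero at 0, it is prime to ['X], and divisibility may be tested after multiplying
   by [d]. *)
have cd : coprimep ('X^(N + N)) d.
  apply: coprimep_expl; rewrite coprimep_sym.
  have := coprimep_XsubC d 0; rewrite subr0 => ->.
  by rewrite /root.
rewrite -(Gauss_dvdpr _ cd).
suff -> : d * (V *m A *m W^T) 0 0
          = (colsub g (V *m A) *m \adj (mxsub f g A) *m rowsub f (A *m W^T)) 0 0.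
  rewrite mxE; apply: dvdp_big_sum => j; rewrite exprD; apply: dvdp_mul.
    rewrite mxE; apply: dvdp_big_sum => i.
    by apply: dvdp_mulr; rewrite mxE.
  (* By skewness the column [A *m W^T] is, up to sign and transposition, the row [W *m A]. *)
  rewrite mxE -[A *m _]trmxK mxE trmx_mul trmxK AT mulmxN mxE dvdpNr.
  exact: WA.
have -> : d * (V *m A *m W^T) 0 0 = (V *m (d *: A) *m W^T) 0 0.
  by rewrite -scalemxAr -scalemxAl [RHS]mxE.
rewrite poly_minor_factorization //; last first.
  by apply: contraNneq d0; rewrite /d => ->; rewrite horner0.
congr (fun_of_matrix _ _ _).
by rewrite -mulmx_colsub -mul_rowsub_mx !mulmxA.
Qed.

Lemma eq_degree_row (N q k l : nat) : (k <= N)%N ->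
  (q == l + (N - k))%N = (l + N == q + k)%N.
Proof. by move=> kN; apply/eqP/eqP; lia. Qed.

Lemma eq_degree_form (N k k' l : nat) : (k <= N)%N -> (k' <= N)%N ->
  (N + N == N - k + (N - k') + l)%N = (l == k + k')%N.
Proof. by move=> kN k'N; apply/eqP/eqP; lia. Qed.

(* [PV u] is [s^N * u(1/s)] for [u(t) = sum_k u_k t^k], and [kills u] says that
   [u(1/s) * PA(s)] has no coefficient in degrees [q - N <= 0]. *)
Section Pencil.
Variables (K : closedFieldType) (n r N L : nat) (A : nat -> 'M[K]_n).
Variables (f g : 'I_r -> 'I_n) (v w : nat -> 'rV[K]_n).
Hypothesis L0 : (0 < L)%N.
Hypothesis AT : forall l, (A l)^T = - A l.
Hypothesis uA : mxsub f g (A 0%N) \in unitmx.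
Hypothesis rA : forall a, (\rank (\sum_(l < L) a ^+ l *: A l)%R <= r)%N.

Let PA : 'M[{poly K}]_n := \sum_(l < L) 'X^l *: map_mx polyC (A l).
Let PV (u : nat -> 'rV[K]_n) : 'rV[{poly K}]_n :=
  \sum_(k < N.+1) 'X^(N - k) *: map_mx polyC (u k).

Let kills (u : nat -> 'rV[K]_n) := forall q, (q <= N)%N ->
  \sum_(k < N.+1) \sum_(l < L | (l + N == q + k)%N) u k *m A l = 0.

(** The coefficient of ['X^q] in [PV u *m PA] is the sum in [kills u] at [q]: the product of
    ['X^(N - k)] and ['X^l] has degree [q] exactly when [l + N = q + k]. *)
Let dvd_PVA u j : kills u -> 'X^(N.+1) %| (PV u *m PA) 0 j.
Proof.
move=> H; suff Hq q : (q <= N)%N -> ((PV u *m PA) 0 j)`_q = 0.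
  rewrite -[X in _ %| X](poly_take_drop N.+1) (_ : take_poly _ _ = 0).
    by rewrite add0r dvdp_mull.
  by apply/polyP => q; rewrite coef_take_poly coef0; case: ifP => // /Hq.
move=> qN; have := congr1 (fun B : 'rV[K]_n => B 0 j) (H q qN).
rewrite [X in _ = X -> _]mxE; apply: etrans.
rewrite mulmx_suml !summxE coef_sum.
rewrite (eq_bigr (fun k : 'I_N.+1 =>
  (\sum_(l < L | (l + N == q + k)%N) u k *m A l) 0 j)) // => k _.
rewrite mulmx_sumr !summxE coef_sum [RHS]big_mkcond /=.
rewrite (eq_bigr (fun l : 'I_L =>
  if (l + N == q + k)%N then (u k *m A l) 0 j else 0)) // => l _.
rewrite -scalemxAr -scalemxAl -map_mxM scalerA -exprD !mxE coefMC coefXn.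
have -> : (q == l + (N - k))%N = (l + N == q + k)%N.
  by rewrite eq_degree_row // -ltnS.
by case: ifP; rewrite ?mul1r ?mul0r.
Qed.

(** The sum is the coefficient of degree [N + N] in [PV v *m PA *m (PV w)^T], which [dvdp_skew_form]
    shows to be divisible by ['X^(N.+1 + N.+1)]. *)
Lemma pencil_skew_form : kills v -> kills w ->
  \sum_(k < N.+1) \sum_(k' < N.+1) \sum_(l < L | (l == k + k' :> nat)%N)
     (v k *m A l *m (w k')^T) 0 0 = 0.
Proof.
move=> Hv Hw.
have PAa a : map_mx (horner_eval a) PA = \sum_(l < L) a ^+ l *: A l.
  rewrite /PA map_mx_sum; apply: eq_bigr => l _.
  apply/matrixP => i j; rewrite !mxE.
  by rewrite -[LHS]/(('X^l * (A l i j)%:P).[a]) hornerM hornerXn hornerC.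
have PAT : PA^T = - PA.
  rewrite /PA raddf_sum -sumrN; apply: eq_bigr => l _ /=.
  by rewrite linearZ /= map_trmx AT map_mxN scalerN.
have dPA : (\det (mxsub f g PA)).[0] != 0.
  rewrite -[_.[0]]/(horner_eval 0 _) -det_map_mx map_mxsub PAa.
  rewrite -unitfE -unitmxE (_ : \sum_(_ < _) _ = A 0%N) //.
  rewrite (bigD1 (Ordinal L0)) //= expr0 scale1r big1 ?addr0 // => l.
  by rewrite -val_eqE /= => /negPf l0; rewrite expr0n l0 scale0r.
have rPA a : (\rank (map_mx (horner_eval a) PA) <= r)%N by rewrite PAa.
have := dvdp_skew_form PAT dPA rPA (fun j => dvd_PVA j Hv) (fun j => dvd_PVA j Hw).
case/dvdpP => p /(congr1 (fun p : {poly K} => p`_(N + N))).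
rewrite coefMXn (_ : (N + N < N.+1 + N.+1)%N = true); last by lia.
move=> E; rewrite -[RHS]E; symmetry.
rewrite /PV [_^T]raddf_sum !mulmx_suml summxE coef_sum.
rewrite (eq_bigr (fun k : 'I_N.+1 => \sum_(k' < N.+1)
  \sum_(l < L | (l == k + k' :> nat)%N) (v k *m A l *m (w k')^T) 0 0)) // => k _.
rewrite mulmx_sumr summxE coef_sum.
rewrite (eq_bigr (fun k' : 'I_N.+1 =>
  \sum_(l < L | (l == k + k' :> nat)%N) (v k *m A l *m (w k')^T) 0 0)) // => k' _.
rewrite mulmx_sumr mulmx_suml summxE coef_sum [RHS]big_mkcond /=.
rewrite (eq_bigr (fun l : 'I_L =>
  if (l == k + k' :> nat)%N then (v k *m A l *m (w k')^T) 0 0 else 0)) // => l _.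
have -> : ('X^(N - k') *: map_mx polyC (w k'))^T
          = 'X^(N - k') *: map_mx polyC (w k')^T by rewrite linearZ /= map_trmx.
rewrite -!(scalemxAl, scalemxAr) -!map_mxM !scalerA -!exprD !mxE coefMC coefXn.
have -> : (N + N == N - k + (N - k' + l))%N = (l == k + k' :> nat)%N.
  by rewrite addnA eq_degree_form // -ltnS.
by case: ifP; rewrite ?mul1r ?mul0r.
Qed.

End Pencil.

(** * The Lie bracket and eigenprojections *)

Section LieBracket.
Variables (K : fieldType) (n : nat) (c : 'I_n -> 'I_n -> 'rV[K]_n).
Implicit Types x y f : 'rV[K]_n.

Lemma pairingE f x : pairing f x = (f *m x^T) 0 0.
Proof. by rewrite mxE; apply: eq_bigr => i _; rewrite mxE. Qed.

Lemma lie_br_delta i j : lie_br c (delta_mx 0 i) (delta_mx 0 j) = c i j.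
Proof.
rewrite /lie_br (bigD1 i) //= (bigD1 j) //= !mxE !eqxx mulr1 scale1r.
rewrite big1 => [|k kj]; last by rewrite !mxE !eqxx (negPf kj) mulr0 scale0r.
rewrite big1 ?addr0 // => k ki; apply: big1 => l _.
by rewrite !mxE !eqxx (negPf ki) mul0r scale0r.
Qed.

Lemma coad_mxE f i j : coad_mx c f i j = pairing f (c i j).
Proof. by rewrite mxE lie_br_delta. Qed.

Lemma coad_mx_is_linear : linear (coad_mx c).
Proof.
move=> a f g; apply/matrixP => i j; rewrite !mxE !lie_br_delta !pairingE.
by rewrite mulmxDl mxE -scalemxAl mxE.
Qed.

HB.instance Definition _ := GRing.isLinear.Build K 'rV[K]_n 'M[K]_n _ (coad_mx c)
  coad_mx_is_linear.

Lemma pairing_lie_br f x y :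
  pairing f (lie_br c x y) = (x *m coad_mx c f *m y^T) 0 0.
Proof.
rewrite /lie_br pairingE raddf_sum mulmx_sumr summxE mxE /=.
under [RHS]eq_bigr => j _ do rewrite mxE mulr_suml.
rewrite exchange_big; apply: eq_bigr => i _ /=.
rewrite raddf_sum mulmx_sumr summxE; apply: eq_bigr => j _ /=.
by rewrite linearZ /= -scalemxAr mxE -pairingE coad_mxE mulrAC [y^T _ _]mxE.
Qed.

Lemma lie_brDl x y w : lie_br c (x + y) w = lie_br c x w + lie_br c y w.
Proof.
rewrite /lie_br -big_split; apply: eq_bigr => i _ /=; rewrite -big_split.
by apply: eq_bigr => j _; rewrite mxE mulrDl scalerDl.
Qed.

Lemma lie_brDr w x y : lie_br c w (x + y) = lie_br c w x + lie_br c w y.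
Proof.
rewrite /lie_br -big_split; apply: eq_bigr => i _ /=; rewrite -big_split.
by apply: eq_bigr => j _; rewrite mxE mulrDr scalerDl.
Qed.

Lemma lie_brZl a x y : lie_br c (a *: x) y = a *: lie_br c x y.
Proof.
rewrite /lie_br scaler_sumr; apply: eq_bigr => i _; rewrite scaler_sumr.
by apply: eq_bigr => j _; rewrite mxE scalerA mulrA.
Qed.

Lemma lie_brZr a x y : lie_br c x (a *: y) = a *: lie_br c x y.
Proof.
rewrite /lie_br scaler_sumr; apply: eq_bigr => i _; rewrite scaler_sumr.
by apply: eq_bigr => j _; rewrite mxE scalerA mulrCA.
Qed.

Lemma lie_br_suml (I : Type) (s : seq I) (x : I -> 'rV[K]_n) y :
  lie_br c (\sum_(i <- s) x i) y = \sum_(i <- s) lie_br c (x i) y.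
Proof.
elim/big_rec2: _ => [|i u v _ <-]; last exact: lie_brDl.
by have := lie_brZl 0 0 y; rewrite !scale0r.
Qed.

Lemma coad_mx_skew f : (forall x, lie_br c x x = 0) ->
  (coad_mx c f)^T = - coad_mx c f.
Proof.
move=> c0; apply/matrixP => i j; rewrite !mxE !lie_br_delta.
apply/eqP; rewrite -subr_eq0 opprK.
(* Polarisation: expanding [[x, x] = 0] at a sum of two basis vectors leaves [c i j + c j i = 0]. *)
have /(congr1 (pairing f)) := c0 (delta_mx 0 i + delta_mx 0 j).
rewrite lie_brDl !lie_brDr !lie_br_delta.
have := c0 (delta_mx 0 i); have := c0 (delta_mx 0 j); rewrite !lie_br_delta.
move=> -> ->; rewrite add0r addr0 !pairingE raddfD mulmxDr /= raddf0 mulmx0.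
by rewrite mxE -!pairingE [X in _ = X -> _]mxE addrC => ->.
Qed.

End LieBracket.

(** Rank and stabiliser dimension add up to [n], so a minimal stabiliser means a maximal rank. *)
Lemma rank_regular (K : fieldType) (n : nat) (c : 'I_n -> 'I_n -> 'rV[K]_n) f :
  is_regular c f -> forall x, (\rank (coad_mx c x) <= \rank (coad_mx c f))%N.
Proof.
move=> reg x; have := reg x; rewrite /stab_dim !mxrank_ker.
by have := rank_leq_row (coad_mx c x); have := rank_leq_row (coad_mx c f); lia.
Qed.

Section EigenProjection.
Variables (K : fieldType) (n : nat) (c : 'I_n -> 'I_n -> 'rV[K]_n).
Variables (Th : 'M[K]_n) (m : nat).
Hypothesis ThM : forall x y, lie_br c (x *m Th) (y *m Th) = lie_br c x y *m Th.
Hypothesis Thm : Th ^+ m = 1%:M.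
Hypothesis m0 : m%:R != 0 :> K.

(** Averaging over the powers of [Th]; for [e ^+ m = 1] this is the projector onto the
    [e]-eigenspace, acting on rows from the right. *)
Definition eigen_proj (e : K) : 'M[K]_n :=
  m%:R^-1 *: \sum_(k < m) e^-1 ^+ k *: Th ^+ k.

(** Multiplication by [Th] shifts the terms of the average cyclically, because [Th ^+ m] and
    [e ^+ m] are both 1. *)
Lemma eigen_proj_eigen e : e ^+ m = 1 -> eigen_proj e *m Th = e *: eigen_proj e.
Proof.
move=> em; have e0 : e != 0.
  apply: contraNneq m0 => e0; move: em; rewrite e0; case: (m) => // k.
  by rewrite exprS mul0r => /esym/eqP; rewrite oner_eq0.
rewrite /eigen_proj -scalemxAl scalerA [e * _]mulrC -scalerA; congr (_ *: _).
rewrite mulmx_suml scaler_sumr.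
pose F k := e^-1 ^+ k *: Th ^+ k.
transitivity (\sum_(k < m) e *: F k.+1).
  apply: eq_bigr => k _; rewrite /F -scalemxAl scalerA.
  by rewrite exprS mulrA divff // mul1r mulmxE -exprSr.
rewrite -!scaler_sumr; congr (_ *: _).
have := erefl (\sum_(i < m.+1) F i); rewrite {1}big_ord_recl big_ord_recr /= addrC.
have -> : F m = F 0%N by rewrite /F Thm expr0 exprVn em invr1 expr0.
exact: addrI.
Qed.

Lemma exp_eigen e (x : 'rV[K]_n) k : x *m Th = e *: x ->
  x *m Th ^+ k = e ^+ k *: x.
Proof.
move=> xe; elim: k => [|k IHk]; first by rewrite mulmx1 scale1r.
by rewrite exprSr -mulmxE mulmxA IHk -scalemxAl xe scalerA -exprSr.
Qed.

Lemma eigen_proj_id e (x : 'rV[K]_n) : e != 0 -> x *m Th = e *: x ->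
  x *m eigen_proj e = x.
Proof.
move=> e0 xe; rewrite -scalemxAr mulmx_sumr.
under eq_bigr => k _ do
  rewrite -scalemxAr (exp_eigen k xe) scalerA exprVn mulVf ?expf_neq0 // scale1r.
by rewrite sumr_const card_ord -scaler_nat scalerA mulVf // scale1r.
Qed.

(** Bracketing with a [b]-eigenvector shifts eigenvalues by the factor [b]: applying [Th ^+ k] to
    [[x, v]] produces [b ^+ k], which cancels against [(a * b)^-1 ^+ k]. *)
Lemma eigen_proj_lie_br a b (x v : 'rV[K]_n) : b != 0 -> v *m Th = b *: v ->
  lie_br c x v *m eigen_proj (a * b) = lie_br c (x *m eigen_proj a) v.
Proof.
move=> b0 vb; rewrite -!scalemxAr lie_brZl; congr (_ *: _).
rewrite !mulmx_sumr lie_br_suml; apply: eq_bigr => k _.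
rewrite -!scalemxAr lie_brZl.
have -> : lie_br c x v *m Th ^+ k = b ^+ k *: lie_br c (x *m Th ^+ k) v.
  rewrite -lie_brZr -(exp_eigen k vb); elim: (k : nat) => [|l IHl].
    by rewrite !mulmx1.
  by rewrite exprSr -mulmxE mulmxA IHl -ThM !mulmxA.
by rewrite scalerA invfM exprMn -mulrA [b^-1 ^+ k]exprVn mulVf ?expf_neq0 ?mulr1.
Qed.

(** After exchanging the sums, the coefficient of [Th ^+ k] is a geometric sum of powers of
    [z^-1 ^+ k], which vanishes for [0 < k < m]. *)
Lemma eigen_proj_sum z : m.-primitive_root z ->
  \sum_(0 <= i < m) eigen_proj (z ^+ i) = 1%:M.
Proof.
move=> pz; rewrite big_mkord -scaler_sumr exchange_big /=.
have mgt0 := prim_order_gt0 pz.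
rewrite (bigD1 (Ordinal mgt0)) //= [X in _ + X]big1 => [|k k0].
  under eq_bigr => i _ do rewrite expr0 scale1r.
  by rewrite sumr_const card_ord addr0 -scaler_nat scalerA mulVf // scale1r.
rewrite -scaler_suml; set s := \sum_(i < m) _.
suff -> : s = 0 by rewrite scale0r.
have w1 : z^-1 ^+ k != 1.
  rewrite exprVn invr_eq1 -(prim_order_dvd pz); apply: contra k0 => mk.
  rewrite -val_eqE /=; case: (posnP k) => // kgt0.
  by have := dvdn_leq kgt0 mk; rewrite leqNgt ltn_ord.
have sE : s = \sum_(i < m) (z^-1 ^+ k) ^+ i.
  by apply: eq_bigr => i _; rewrite -exprVn -!exprM mulnC.
have := subrX1 (z^-1 ^+ k) m; rewrite -sE -exprM mulnC exprM [z^-1 ^+ m]exprVn.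
rewrite (prim_expr_order pz) invr1 expr1n subrr => /esym/eqP.
by rewrite mulf_eq0 subr_eq0 (negPf w1) => /eqP.
Qed.

End EigenProjection.

(** * Differentials at a point *)

(** Trades residues mod [m] for integer exponents, so that eigenvalues multiply as degrees in [t]
    add. *)
Lemma exp_bar (F : fieldType) (z : F) (m : nat) (j : int) :
  m.-primitive_root z -> z ^+ bar m j = z ^ j.
Proof.
move=> pz; have mgt0 := prim_order_gt0 pz.
have z0 : z != 0 by rewrite (prim_root_eq0 pz) -lt0n.
have m0 : m%:Z != 0 by rewrite eqz_nat -lt0n.
have := divz_eq j m%:Z; move: (modz_ge0 j m0); rewrite /bar.
case: (modz j m%:Z) => // r _ -> /=.
have zm : z ^ (m%:Z) = 1 by rewrite -(prim_expr_order pz).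
by rewrite expfzDr // mulrC [_ * m%:Z]mulrC -exprz_exp zm exp1rz mulr1.
Qed.

Section Rows.
Variables (K : fieldType) (n : nat) (c : 'I_n -> 'I_n -> 'rV[K]_n).
Variable th : Var n -> K.
Implicit Types (g h : SP K n) (k j : int).

(** A point [th] is a linear form on the loop algebra, given on a basis; this is its restriction to
    [q t^j]. *)
Definition point_row j : 'rV[K]_n := \row_i th (i, j).

(** The differential of [g] at [th] is an element of the loop algebra; this is its coefficient of
    [t^k]. *)
Definition diff_row k g : 'rV[K]_n := \row_i ev idfun th (pderiv (i, k) g).

Lemma diff_rowE k g i : diff_row k g 0 i = ev idfun th (pderiv (i, k) g).
Proof. exact: mxE. Qed.

Lemma diff_row1 k : diff_row k 1 = 0.
Proof.
apply/rowP => i; rewrite [RHS]mxE; apply: etrans (diff_rowE k 1 i) _.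
exact: ev_pderiv1.
Qed.

Lemma diff_rowZ k a g : diff_row k (a *: g) = a *: diff_row k g.
Proof.
apply/rowP => i; rewrite [RHS]mxE; apply: etrans (diff_rowE k (a *: g) i) _.
rewrite pderivZ evZ; congr (_ * _); exact: (esym (diff_rowE _ _ _)).
Qed.

Lemma diff_rowD k g h : diff_row k (g + h) = diff_row k g + diff_row k h.
Proof.
apply/rowP => i; rewrite [RHS]mxE; apply: etrans (diff_rowE k (g + h) i) _.
apply: etrans (ev_pderivD idfun th (i, k) g h) _.
by congr (_ + _); exact: (esym (diff_rowE _ _ _)).
Qed.

Lemma diff_rowM k g h :
  diff_row k (g * h) = ev idfun th h *: diff_row k g + ev idfun th g *: diff_row k h.
Proof.
apply/rowP => i; rewrite [RHS]mxE [X in _ = X + _]mxE [X in _ = _ + X]mxE.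
apply: etrans (diff_rowE k (g * h) i) _.
apply: etrans (ev_pderivM idfun th (i, k) g h) _.
congr (_ + _); last by congr (_ * _); exact: (esym (diff_rowE _ _ _)).
apply: etrans (mulrC _ _) _; congr (_ * _); exact: (esym (diff_rowE _ _ _)).
Qed.

Lemma diff_row_lt k x j : diff_row k (lt x j) = (k == j)%:R *: x.
Proof.
apply/rowP => i; rewrite [RHS]mxE; apply: etrans (diff_rowE k (lt x j) i) _.
rewrite ev_pderiv_lt; exact: mulrC.
Qed.

Lemma ev_lt_row x j : ev idfun th (lt x j) = pairing (point_row j) x.
Proof. by rewrite ev_lt; apply: eq_bigr => i _; rewrite mxE mulrC. Qed.

(** The Lie-Poisson bracket at a point is the point applied to the Lie bracket of the two
    differentials; sorting variables by their degree in [t] gives one bilinear form per pair of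
    degrees. *)
Lemma ev_pbr (s t : seq int) g h : uniq s -> uniq t ->
  (forall k, k \notin s -> diff_row k g = 0) ->
  (forall k, k \notin t -> diff_row k h = 0) ->
  ev idfun th (pbr c g h) = \sum_(k <- s) \sum_(k' <- t)
    (diff_row k g *m coad_mx c (point_row (k + k')) *m (diff_row k' h)^T) 0 0.
Proof.
move=> us ut gs ht.
pose sV (s : seq int) : seq (Var n) := [seq (i, k) | k <- s, i <- enum 'I_n].
have usV s' : uniq s' -> uniq (sV s').
  move=> us'; apply: allpairs_uniq; rewrite ?enum_uniq //.
  by move=> [a1 a2] [b1 b2] _ _ [-> ->].
have supp s' g' : (forall k, k \notin s' -> diff_row k g' = 0) ->
  forall a, a \notin sV s' -> ev idfun th (pderiv a g') = 0.
  move=> g's' [i k] ik; have /g's' /rowP /(_ i) : k \notin s'.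
    by apply: contra ik => ks'; apply/allpairsP; exists (k, i); rewrite mem_enum.
  by rewrite !mxE.
have sumV s' (G : Var n -> K) :
    \sum_(a <- sV s') G a = \sum_(k <- s') \sum_i G (i, k).
  by rewrite big_allpairs_dep; apply: eq_bigr => k _; rewrite big_enum.
pose p a := ev idfun th (pderiv a g); pose q a := ev idfun th (pderiv a h).
transitivity (\sum_(a <- vars g) \sum_(b <- vars h)
    p a * q b * ev idfun th (xbr c a b)).
  rewrite /pbr ev_sum; apply: eq_bigr => a _; rewrite ev_sum.
  apply: eq_bigr => b _; apply: etrans (evM _ _ _ _) _.
  by congr (_ * _); apply: evM.
have p0 a : a \notin vars g -> p a = 0.
  by move=> ag; rewrite /p pderiv_notin_vars // ev0.
have q0 a : a \notin vars h -> q a = 0.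
  by move=> ah; rewrite /q pderiv_notin_vars // ev0.
rewrite (bilinear_supp _ (vars_uniq g) (vars_uniq h) (usV _ us) (usV _ ut)
  p0 (supp _ _ gs) q0 (supp _ _ ht)).
rewrite sumV; apply: eq_bigr => k _.
transitivity (\sum_(k' <- t) \sum_j \sum_i
    p (i, k) * q (j, k') * coad_mx c (point_row (k + k')) i j).
  under eq_bigr => i _ do rewrite sumV.
  rewrite exchange_big; apply: eq_bigr => k' _ /=; rewrite exchange_big.
  apply: eq_bigr => j _; apply: eq_bigr => i _; congr (_ * _).
  by rewrite ev_lt_row coad_mxE lie_br_delta.
apply: eq_bigr => k' _; rewrite [RHS]mxE; apply: eq_bigr => j _.
rewrite [X in _ = X * _]mxE [X in _ = _ * X]mxE mulr_suml.
apply: eq_bigr => i _; rewrite mulrAC.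
by congr (_ * _ * _); exact: (esym (diff_rowE _ _ _)).
Qed.

End Rows.

(** The bound is the largest absolute degree of a variable of [g], hence independent of the
    point. *)
Lemma diff_row_bounded (K : fieldType) (n : nat) (g : SP K n) :
  exists N : nat, forall th k, (N < absz k)%N -> diff_row th k g = 0.
Proof.
exists (\max_(a <- vars g) absz a.2)%N => th k Nk; apply/rowP => i; rewrite !mxE.
rewrite pderiv_notin_vars ?ev0 //; apply: contraL Nk => ikg.
by rewrite -leqNgt (@leq_bigmax_seq _ _ xpredT (fun a : Var n => absz a.2) (i, k)).
Qed.

Section SPlus.
Variables (K : fieldType) (n : nat) (c : 'I_n -> 'I_n -> 'rV[K]_n).
Variables (Th : 'M[K]_n) (m : nat) (z : K).
Hypothesis pz : m.-primitive_root z.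

Lemma in_eigP (x : 'rV[K]_n) (j : int) :
  in_eig Th z (bar m j) x <-> x *m Th = z ^ j *: x.
Proof. by rewrite /in_eig exp_bar. Qed.

(** By the Leibniz rule the differential is a linear combination of generators, so its [t^k] part
    lies in every subspace [Q] that contains the generators of degree [k]. *)
Lemma diff_row_S_plus (th : Var n -> K) (Q : 'rV[K]_n -> Prop) (k : int)
    (Y : SP K n) :
  Q 0 -> (forall a u, Q u -> Q (a *: u)) -> (forall u v, Q u -> Q v -> Q (u + v)) ->
  (forall x, 0 <= k -> x *m Th = z ^ (- k) *: x -> Q x) ->
  S_plus Th z m Y -> Q (diff_row th k Y).
Proof.
move=> Q0 QZ QD Qk.
elim=> [_ [j [x [j0 [/in_eigP xj ->]]]]||a y _ Qy|y w _ Qy _ Qw|y w _ Qy _ Qw].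
- rewrite diff_row_lt; case: eqVneq => [kj|_]; last by rewrite scale0r.
  by rewrite scale1r; apply: Qk; rewrite kj.
- by rewrite diff_row1.
- by rewrite diff_rowZ; apply: QZ.
- by rewrite diff_rowD; apply: QD.
by rewrite diff_rowM; apply: QD; apply: QZ.
Qed.

Lemma diff_row_neg th k Y : S_plus Th z m Y -> k < 0 -> diff_row th k Y = 0.
Proof.
move=> SY k0; apply: (@diff_row_S_plus th (fun u => u = 0)) SY => //.
- by move=> a u ->; rewrite scaler0.
- by move=> u v -> ->; rewrite addr0.
by move=> x; rewrite Num.Theory.real_leNgt ?Num.Theory.num_real // k0.
Qed.

Lemma diff_row_eigen th k Y : S_plus Th z m Y ->
  diff_row th k Y *m Th = z ^ (- k) *: diff_row th k Y.
Proof.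
move=> SY; apply: (@diff_row_S_plus th (fun u => u *m Th = z ^ (- k) *: u)) SY => //.
- by rewrite mul0mx scaler0.
- by move=> a u uk; rewrite -scalemxAl uk !scalerA mulrC.
by move=> u v uk vk; rewrite mulmxDl uk vk scalerDr.
Qed.

(** Elements of [S_plus] are polynomials in generators whose values are the pairings in the
    hypothesis and whose differentials are the same at all points. *)
Lemma S_plus_eq_at th th' Y :
  (forall j x, 0 <= j -> x *m Th = z ^ (- j) *: x ->
     pairing (point_row th j) x = pairing (point_row th' j) x) ->
  S_plus Th z m Y ->
  ev idfun th Y = ev idfun th' Y /\ forall k, diff_row th k Y = diff_row th' k Y.
Proof.
move=> E; elim=> [_ [j [x [j0 [/in_eigP xj ->]]]]||a y _ [e1 e2]
  |y w _ [e1 e2] _ [e3 e4]|y w _ [e1 e2] _ [e3 e4]].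
- by rewrite !ev_lt_row; split=> [|k]; [exact: E | rewrite !diff_row_lt].
- by rewrite !ev1; split=> // k; rewrite !diff_row1.
- split=> [|k].
    apply: etrans (evZ _ _ a y) _; apply: etrans _ (esym (evZ _ _ a y)).
    by rewrite e1.
  apply: etrans (diff_rowZ _ _ a y) _; apply: etrans _ (esym (diff_rowZ _ _ a y)).
  by rewrite e2.
- split=> [|k].
    apply: etrans (evD _ _ y w) _; apply: etrans _ (esym (evD _ _ y w)).
    by congr (_ + _).
  apply: etrans (diff_rowD _ _ y w) _; apply: etrans _ (esym (diff_rowD _ _ y w)).
  by congr (_ + _); [exact: e2 | exact: e4].
split=> [|k].
  apply: etrans (evM _ _ y w) _; apply: etrans _ (esym (evM _ _ y w)).
  by congr (_ * _).
apply: etrans (diff_rowM _ _ y w) _; apply: etrans _ (esym (diff_rowM _ _ y w)).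
by rewrite e1 e3 e2 e4.
Qed.

Definition nat_degrees (N : nat) : seq int := [seq i%:Z | i <- iota 0 N].

(** Stated for every [N] above the bound, so that two elements can share one range of degrees. *)
Lemma diff_row_S_plus_bounded Y : S_plus Th z m Y ->
  exists N0 : nat, forall N th k, (N0 <= N)%N -> k \notin nat_degrees N.+1 ->
  diff_row th k Y = 0.
Proof.
move=> SY; have [N0 HN0] := diff_row_bounded Y; exists N0 => N th [k|k] N0N kN.
  apply: HN0; apply: leq_ltn_trans N0N _; rewrite ltnNge; apply: contra kN => kN.
  by apply/mapP; exists k; rewrite // mem_iota.
exact: diff_row_neg SY _.
Qed.

Lemma big_nat_degrees (N : nat) (F : int -> K) :
  \sum_(k <- nat_degrees N) F k = \sum_(k < N) F k%:Z.
Proof. by rewrite big_map -(big_mkord xpredT (fun k => F k%:Z)) /index_iota subn0. Qed.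

Lemma nat_degrees_uniq N : uniq (nat_degrees N).
Proof. by rewrite map_inj_uniq ?iota_uniq // => i j []. Qed.

End SPlus.

(** * Twisted points *)

Lemma diff_row_sum (K : fieldType) (n : nat) (th : Var n -> K) (k : int)
    (I : Type) (r : seq I) (F : I -> SP K n) :
  diff_row th k (\sum_(i <- r) F i) = \sum_(i <- r) diff_row th k (F i).
Proof.
elim/big_rec2: _ => [|i u v _ <-]; last exact: diff_rowD.
by apply/rowP => i; rewrite [RHS]mxE diff_rowE pderiv0; apply: ev0.
Qed.

(** The list of [p] zeros followed by [x] encodes the single element [x t^(-p)]. *)
Lemma diff_row_neg_loop (K : fieldType) (n : nat) (th : Var n -> K) (k : int)
    (x : 'rV[K]_n) (p : nat) :
  diff_row th k (neg_loop_elt (rcons (nseq p 0) x)) = (k == - p%:Z)%:R *: x.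
Proof.
rewrite diff_row_sum; set xs := rcons _ _.
apply: etrans (eq_bigr _ (fun (l : 'I_(size xs)) _ =>
  diff_row_lt th k xs`_l (- (l%:Z)))) _.
rewrite /xs size_rcons size_nseq big_ord_recr /=.
rewrite nth_rcons size_nseq ltnn eqxx big1 ?add0r // => l _.
by rewrite nth_rcons size_nseq ltn_ord nth_nseq ltn_ord scaler0.
Qed.

Lemma skew_mul_entry (R : comNzRingType) (n : nat) (A : 'M[R]_n) (v : 'rV[R]_n) j :
  A^T = - A -> (v *m A) 0 j = - ((delta_mx 0 j : 'rV_n) *m A *m v^T) 0 0.
Proof.
move=> AT.
have -> : (delta_mx 0 j : 'rV_n) *m A *m v^T = (v *m A^T *m delta_mx j 0)^T.
  by rewrite !trmx_mul trmx_delta trmxK mulmxA.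
by rewrite AT mulmxN mulNmx -colE [in RHS]mxE [X in _ = - X]mxE opprK [RHS]mxE.
Qed.

Lemma eq_degree_shift (N q k l : nat) : (q <= N)%N -> (N - q <= k)%N ->
  (l + N == q + k)%N = (l == k - (N - q))%N.
Proof. by move=> qN Nk; apply/eqP/eqP; lia. Qed.

Lemma eq_degree_shift_neg (N q k l : nat) : (k < N - q)%N ->
  (l + N == q + k)%N = false.
Proof. by move=> kN; apply/eqP; lia. Qed.

Section TwistedPoint.
Variables (K : closedFieldType) (n : nat) (c : 'I_n -> 'I_n -> 'rV[K]_n).
Variables (Th : 'M[K]_n) (m : nat) (z : K).
Hypothesis c0 : forall x, lie_br c x x = 0.
Hypothesis ThM : forall x y, lie_br c (x *m Th) (y *m Th) = lie_br c x y *m Th.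
Hypothesis Thm : Th ^+ m = 1%:M.
Hypothesis pz : m.-primitive_root z.

Let m0 : m%:R != 0 :> K := prim_root_natf_neq0 pz.

Let z0 : z != 0.
Proof. by rewrite (prim_root_eq0 pz) -lt0n (prim_order_gt0 pz). Qed.

Lemma expz_order (j : int) : (z ^ j) ^+ m = 1.
Proof.
have zm : z ^ (m%:Z) = 1 by rewrite -(prim_expr_order pz).
by rewrite exprnP exprz_exp mulrC -exprz_exp zm exp1rz.
Qed.

(* [f] is the part in degree [t^j] of a linear form on the twisted loop algebra
   vanishing on negative powers of [t], extended by zero to the other eigenspaces. *)
Definition twisted_form (j : int) (f : 'rV[K]_n) : Prop :=
  (j < 0 -> f = 0) /\
  (forall x, pairing f (x *m eigen_proj Th m (z ^ (- j))) = pairing f x).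

Definition twisted_point (th : Var n -> K) : Prop :=
  forall j, twisted_form j (point_row th j).

(** Each generator of the ideal has a factor of negative degree in [t], where a twisted point
    vanishes. *)
Lemma ev_in_ideal (th : Var n -> K) (y : SP K n) : twisted_point th ->
  in_ideal (S_all Th z m) (gen_neg Th z m) y -> ev idfun th y = 0.
Proof.
move=> tw; elim=> [_ r [j [x [jneg [_ ->]]]] _||u v _ eu _ ev0].
- apply: etrans (evM _ _ _ _) _; rewrite ev_lt_row (tw j).1 //.
  by rewrite pairingE mul0mx mxE mul0r.
- exact: ev0.
apply: etrans (evD _ _ _ _) _; apply: etrans (congr2 +%R eu ev0) _.
exact: addr0.
Qed.

(** Projecting [x] here amounts to projecting [[x, v]] to the eigenvalue [z ^ (- j)], a projection
    that [f] does not see. *)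
Lemma pairing_twisted (j k : int) (f x v : 'rV[K]_n) :
  twisted_form j f -> v *m Th = z ^ (- k) *: v ->
  pairing f (lie_br c (x *m eigen_proj Th m (z ^ (k - j))) v)
  = pairing f (lie_br c x v).
Proof.
move=> [_ tw] vk.
rewrite -(@eigen_proj_lie_br _ _ _ _ m ThM _ (z ^ (- k)) x v _ vk) ?expfz_neq0 //.
by rewrite -expfzDr // addrAC subrr add0r tw.
Qed.

(** For the differential [V] of [Y], invariance under [x t^(-p)], evaluated at [th], says
    [th([x t^(-p), V]) = 0]. Up to sign, the row below is this expression as a covector in [x]. *)
Lemma Zcal_rows (th : Var n -> K) (Y : SP K n) (N p : nat) : twisted_point th ->
  Zcal c Th z m Y ->
  (forall k, k \notin nat_degrees N.+1 -> diff_row th k Y = 0) ->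
  \sum_(k < N.+1) diff_row th k Y *m coad_mx c (point_row th (k%:Z - p%:Z)) = 0.
Proof.
move=> tw [SY ZY] YN; pose v (k : int) := diff_row th k Y.
pose A (k : int) := coad_mx c (point_row th (k - p%:Z)).
have eig (x : 'rV[K]_n) : x *m Th = z ^ p%:Z *: x ->
    \sum_(k < N.+1) (x *m A k%:Z *m (v k%:Z)^T) 0 0 = 0.
  move=> xp; pose xs := rcons (nseq p 0) x.
  have nx : is_neg_twisted Th z m xs.
    move=> k; rewrite size_rcons size_nseq nth_rcons size_nseq ltnS => kp.
    apply/(in_eigP Th pz); case: ltngtP kp => // [kp _|-> //].
    by rewrite nth_nseq kp mul0mx scaler0.
  have := ev_in_ideal tw (ZY xs nx).
  rewrite (@ev_pbr _ _ _ _ [:: - p%:Z] (nat_degrees N.+1)) //.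
  - rewrite big_seq1 big_nat_degrees => e; apply: etrans e.
    apply: eq_bigr => k _; rewrite diff_row_neg_loop eqxx scale1r.
    by rewrite addrC.
  - exact: nat_degrees_uniq.
  move=> k; rewrite inE diff_row_neg_loop => /negPf ->.
  exact: scale0r.
(* Replacing [x] by its component in the eigenspace that matches [t^(-p)] does not
   change the sum, so the condition extends to all [x]. *)
have gen (x : 'rV[K]_n) : \sum_(k < N.+1) (x *m A k%:Z *m (v k%:Z)^T) 0 0 = 0.
  pose x' := x *m eigen_proj Th m (z ^ p%:Z).
  apply: etrans (eig x' _); last first.
    by rewrite -mulmxA eigen_proj_eigen ?expz_order // -scalemxAr.
  apply: eq_bigr => k _; rewrite -!pairing_lie_br.
  have vk := diff_row_eigen pz th k%:Z SY.
  rewrite -(pairing_twisted x (tw (k%:Z - p%:Z)) vk).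
  by rewrite subKr.
apply/rowP => j; rewrite summxE [RHS]mxE; pose d : 'rV[K]_n := delta_mx 0 j.
rewrite (eq_bigr (fun k : 'I_N.+1 => - (d *m A k%:Z *m (v k%:Z)^T) 0 0)).
  by rewrite sumrN gen oppr0.
by move=> k _; apply: skew_mul_entry; apply: coad_mx_skew.
Qed.

(** An instance of [pencil_skew_form], where [A l] is the form attached to the degree [l] part of
    [th]. By linearity each member of the pencil is [coad_mx] of one covector, which bounds its
    rank. *)
Lemma ev_pbr_Zcal (th : Var n -> K) (Y1 Y2 : SP K n) (r : nat)
    (f g : 'I_r -> 'I_n) : twisted_point th ->
  (forall x, \rank (coad_mx c x) <= r)%N ->
  mxsub f g (coad_mx c (point_row th 0)) \in unitmx ->
  Zcal c Th z m Y1 -> Zcal c Th z m Y2 -> ev idfun th (pbr c Y1 Y2) = 0.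
Proof.
move=> tw rk um Z1 Z2.
have [N1 HN1] := diff_row_S_plus_bounded pz Z1.1.
have [N2 HN2] := diff_row_S_plus_bounded pz Z2.1.
pose N := maxn N1 N2.
have Y1N := HN1 N th _ (leq_maxl N1 N2); have Y2N := HN2 N th _ (leq_maxr N1 N2).
have uN := nat_degrees_uniq N.+1; apply: etrans (ev_pbr c uN uN Y1N Y2N) _.
rewrite big_nat_degrees.
(* The degrees [k + k'] with [k] and [k'] at most [N] run up to [N + N]. *)
pose L := (N + N).+1; pose A (l : nat) := coad_mx c (point_row th l%:Z).
have AT l : (A l)^T = - A l by exact: coad_mx_skew.
have rA a : (\rank (\sum_(l < L) a ^+ l *: A l)%R <= r)%N.
  rewrite (_ : \sum_(l < L) _ = coad_mx c (\sum_(l < L) a ^+ l *: point_row th l%:Z)).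
    exact: rk.
  by rewrite raddf_sum; apply: eq_bigr => l _; rewrite /= linearZ.
have kills Y : Zcal c Th z m Y ->
    (forall k, k \notin nat_degrees N.+1 -> diff_row th k Y = 0) ->
    forall q, (q <= N)%N -> \sum_(k < N.+1) \sum_(l < L | (l + N == q + k)%N)
      diff_row th k%:Z Y *m A l = 0.
  (* With [p = N - q], the only index allowed in the inner sum is [l = k - p]. For [k < p] there is
     none, and the matching term of [Zcal_rows] vanishes because [th] is zero in negative
     degrees. *)
  move=> ZY YN q qN; rewrite -[RHS](Zcal_rows (N - q) tw ZY YN).
  apply: eq_bigr => k _; have kN : (k <= N)%N by rewrite -ltnS.
  have [kq|kq] := leqP (N - q) k.
    have lL : (k - (N - q) < L)%N.
      by rewrite ltnS (leq_trans (leq_subr _ _)) // (leq_trans kN) ?leq_addr.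
    rewrite (big_pred1 (Ordinal lL)) => [|l]; last exact: eq_degree_shift.
    by rewrite /A /= subzn.
  rewrite big_pred0 => [|l]; last exact: eq_degree_shift_neg.
  rewrite (tw _).1; first by rewrite raddf0 mulmx0.
  by rewrite Num.Theory.subr_lt0 ltz_nat.
have := @pencil_skew_form K n r N L A f g (fun k => diff_row th k%:Z Y1)
  (fun k => diff_row th k%:Z Y2) isT AT um rA (kills Y1 Z1 Y1N) (kills Y2 Z2 Y2N).
move=> e; apply: etrans e; apply: eq_bigr => k _; rewrite big_nat_degrees.
apply: eq_bigr => k' _; have lL : (k + k' < L)%N.
  by rewrite /L ltnS leq_add // -ltnS.
rewrite (big_pred1 (Ordinal lL)) => [|l]; last by [].
by rewrite /A /= -PoszD.
Qed.

End TwistedPoint.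

(** * Twisting a point and moving it along a line *)

Lemma eq_ev (K : fieldType) (n : nat) (v v' : Var n -> K) (g : SP K n) :
  v =1 v' -> ev idfun v g = ev idfun v' g.
Proof.
move=> vv'; rewrite /ev !mmapE; apply: eq_bigr => k _; congr (_ * _).
by apply: eq_bigr => b _; rewrite vv'.
Qed.

Lemma ev_horner (K : fieldType) (n : nat) (v : Var n -> {poly K}) (a : K)
    (g : SP K n) :
  (ev polyC v g).[a] = ev idfun (fun b => (v b).[a]) g.
Proof.
rewrite /ev !mmapE horner_sum; apply: eq_bigr => k _.
rewrite hornerM hornerC horner_prod; congr (_ * _).
by apply: eq_bigr => b _; rewrite horner_exp.
Qed.

Lemma horner_det_pencil (K : fieldType) (n r : nat) (A B : 'M[K]_n)
    (f g : 'I_r -> 'I_n) (a : K) :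
  (\det (mxsub f g ('X *: map_mx polyC A + (1 - 'X) *: map_mx polyC B))).[a]
  = \det (mxsub f g (a *: A + (1 - a) *: B)).
Proof.
rewrite -[LHS]/(horner_eval a _) -det_map_mx map_mxsub; congr (\det (mxsub f g _)).
apply/matrixP => i j; rewrite !mxE.
rewrite -[LHS]/(('X * (A i j)%:P + (1 - 'X) * (B i j)%:P).[a]).
by rewrite !hornerE.
Qed.

Section Projection.
Variables (K : closedFieldType) (n : nat) (c : 'I_n -> 'I_n -> 'rV[K]_n).
Variables (Th : 'M[K]_n) (m : nat) (z : K).
Hypothesis c0 : forall x, lie_br c x x = 0.
Hypothesis ThM : forall x y, lie_br c (x *m Th) (y *m Th) = lie_br c x y *m Th.
Hypothesis Thm : Th ^+ m = 1%:M.
Hypothesis pz : m.-primitive_root z.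

Let m0 : m%:R != 0 :> K := prim_root_natf_neq0 pz.

Let z0 : z != 0.
Proof. by rewrite (prim_root_eq0 pz) -lt0n (prim_order_gt0 pz). Qed.

Lemma twisted_form_comb j a b f g : twisted_form Th m z j f ->
  twisted_form Th m z j g -> twisted_form Th m z j (a *: f + b *: g).
Proof.
move=> [f0 tf] [g0 tg]; split=> [j0|x]; first by rewrite f0 // g0 // !scaler0 addr0.
have gen (u : 'rV[K]_n) :
    pairing (a *: f + b *: g) u = a * pairing f u + b * pairing g u.
  by rewrite !pairingE mulmxDl -!scalemxAl mxE [X in X + _]mxE [X in _ + X]mxE.
by rewrite !gen tf tg.
Qed.

Lemma twisted_form0 j : twisted_form Th m z j 0.
Proof. by split=> // x; rewrite !pairingE !mul0mx. Qed.

(** The difference between [x] and its projection to the eigenvalue 1 is the sum of its other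
    eigencomponents, which [f] annihilates. *)
Lemma twisted_form_q0star f : in_q0star Th z m f -> twisted_form Th m z 0 f.
Proof.
move=> f0; split=> // x; rewrite oppr0 expr0z.
have := f0 (fun i => x *m eigen_proj Th m (z ^+ i)).
have mgt0 := prim_order_gt0 pz.
have := eigen_proj_sum Th m0 pz.
rewrite big_ltn // expr0 => /(congr1 (mulmx x)); rewrite mulmx1 mulmxDr mulmx_sumr.
set s := \sum_(1 <= i < m) _ => xE fs.
have fs0 : pairing f s = 0.
  apply: fs => i im; rewrite /in_eig -mulmxA eigen_proj_eigen // -?scalemxAr //.
  by rewrite -exprM mulnC exprM (prim_expr_order pz) expr1n.
rewrite -[in RHS]xE pairingE [in RHS]pairingE raddfD /= mulmxDr [RHS]mxE.
by rewrite -[X in _ = _ + X]pairingE fs0 addr0.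
Qed.

(* The functions in [S_plus] do not distinguish a point from its image under
   [twist], so it is enough to evaluate them at twisted points. *)
Definition twist (th : Var n -> K) : Var n -> K := fun a =>
  if a.2 < 0 then 0
  else (point_row th a.2 *m (eigen_proj Th m (z ^ (- a.2)))^T) 0 a.1.

Lemma pairing_twist th j x : 0 <= j ->
  pairing (point_row (twist th) j) x
  = pairing (point_row th j) (x *m eigen_proj Th m (z ^ (- j))).
Proof.
move=> j0; rewrite !pairingE trmx_mul mulmxA; congr ((_ *m _) 0 0).
apply/rowP => i; rewrite [LHS]mxE /twist /=.
by rewrite Num.Theory.real_ltNge ?Num.Theory.num_real // j0.
Qed.

Lemma twist_twisted th : twisted_point Th m z (twist th).
Proof.
move=> j; split=> [j0|x]; first by apply/rowP => i; rewrite !mxE /twist /= j0.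
have [j0|j0] := Num.Theory.ltrP j 0.
  rewrite (_ : point_row _ _ = 0) ?pairingE ?mul0mx //.
  by apply/rowP => i; rewrite !mxE /twist /= j0.
rewrite !pairing_twist //; congr pairing; apply: eigen_proj_id => //.
  exact: expfz_neq0.
by rewrite -mulmxA eigen_proj_eigen ?expz_order // -scalemxAr.
Qed.

Lemma twist_eigen th j x : 0 <= j -> x *m Th = z ^ (- j) *: x ->
  pairing (point_row th j) x = pairing (point_row (twist th) j) x.
Proof. by move=> j0 xj; rewrite pairing_twist // eigen_proj_id // expfz_neq0. Qed.

(** In the expansion [ev_pbr] the differentials at both points agree, and the bracket of their parts
    of degrees [k] and [k'] lies in the eigenspace of [z ^ (- (k + k'))], where twisting changes no
    pairing. *)
Lemma ev_pbr_twist th Y1 Y2 : S_plus Th z m Y1 -> S_plus Th z m Y2 ->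
  ev idfun th (pbr c Y1 Y2) = ev idfun (twist th) (pbr c Y1 Y2).
Proof.
move=> S1 S2.
have [_ E1] := S_plus_eq_at pz (@twist_eigen th) S1.
have [_ E2] := S_plus_eq_at pz (@twist_eigen th) S2.
have [N1 HN1] := diff_row_S_plus_bounded pz S1.
have [N2 HN2] := diff_row_S_plus_bounded pz S2.
have uN1 := nat_degrees_uniq N1.+1; have uN2 := nat_degrees_uniq N2.+1.
apply: etrans (ev_pbr c uN1 uN2 (HN1 _ th ^~ (leqnn _)) (HN2 _ th ^~ (leqnn _))) _.
apply: etrans _ (esym (ev_pbr c uN1 uN2 (HN1 _ (twist th) ^~ (leqnn _))
  (HN2 _ (twist th) ^~ (leqnn _)))).
rewrite !big_nat_degrees; apply: eq_bigr => k _.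
rewrite !big_nat_degrees; apply: eq_bigr => k' _.
rewrite -E1 -E2 -!pairing_lie_br pairing_twist //.
set v := diff_row _ _ Y1; set w := diff_row _ _ Y2; congr pairing.
have v1 : v *m Th = z ^ (- k%:Z) *: v by exact: (diff_row_eigen pz th k%:Z S1).
have w1 : w *m Th = z ^ (- k'%:Z) *: w by exact: (diff_row_eigen pz th k'%:Z S2).
move: v w v1 w1 => v w v1 w1; have e0 i : z ^ i != 0 by apply: expfz_neq0.
rewrite opprD expfzDr // (@eigen_proj_lie_br _ _ _ _ m ThM _ _ v w (e0 _) w1).
by rewrite (@eigen_proj_id _ _ _ m m0 _ v (e0 _) v1).
Qed.

(* On the line joining [eta] to the point [f] (in degree 0), the degree-0 part is
   regular outside the zeros of the nonzero polynomial [D]. *)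
Lemma pbr_Zcal_eq0 f Y1 Y2 : [pchar K] =i pred0 ->
  is_regular c f -> twisted_form Th m z 0 f ->
  Zcal c Th z m Y1 -> Zcal c Th z m Y2 -> pbr c Y1 Y2 = 0.
Proof.
move=> ch reg tf Z1 Z2; apply: (ev_inj0 ch) => th.
rewrite (ev_pbr_twist th Z1.1 Z2.1); set eta := twist th.
have [f1 [g1 uf]] := invertible_minor_exists (coad_mx c f).
pose f' (j : int) : 'rV[K]_n := if j == 0 then f else 0.
(* The line passes through [f'] at parameter 0 and [eta] at 1: [D.[0]] is the invertible minor of
   [f], and [Q.[1]] is the value sought. *)
pose P (a : Var n) : {poly K} :=
  'X * (eta a)%:P + (1 - 'X) * (f' a.2 0 a.1)%:P.
pose A := coad_mx c (point_row eta 0).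
pose D := \det (mxsub f1 g1
  ('X *: map_mx polyC A + (1 - 'X) *: map_mx polyC (coad_mx c f))).
pose Q := ev polyC P (pbr c Y1 Y2).
pose pt mu (a : Var n) := mu * eta a + (1 - mu) * f' a.2 0 a.1.
have QE mu : Q.[mu] = ev idfun (pt mu) (pbr c Y1 Y2).
  rewrite /Q ev_horner; apply: eq_ev => a.
  by rewrite !hornerE.
have rowE mu j : point_row (pt mu) j = mu *: point_row eta j + (1 - mu) *: f' j.
  by apply/rowP => i; rewrite !mxE.
have twE mu : twisted_point Th m z (pt mu).
  move=> j; rewrite rowE; apply: twisted_form_comb; first exact: twist_twisted.
  by rewrite /f'; case: eqP => [->|_] //; apply: twisted_form0.
have D0 : D != 0.
  apply/eqP => D0; have := congr1 (fun p : {poly K} => p.[0]) D0.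
  rewrite horner_det_pencil horner0 scale0r add0r subr0 scale1r.
  by move/eqP; apply/negP; rewrite -unitfE -unitmxE.
have QD : D * Q = 0.
  apply: poly_eq0_closed => mu; rewrite hornerM.
  have [->|Dmu] := eqVneq D.[mu] 0; first by rewrite mul0r.
  rewrite QE (ev_pbr_Zcal c0 ThM Thm pz (f := f1) (g := g1)) ?mulr0 //.
    exact: rank_regular.
  rewrite rowE /f' eqxx raddfD /= !linearZ /= unitmxE unitfE.
  by rewrite -horner_det_pencil.
move/eqP: QD; rewrite mulf_eq0 (negPf D0) /= => /eqP Q0.
have := QE 1; rewrite Q0 horner0 => e; rewrite [RHS]e.
by apply: eq_ev => a; rewrite /pt mul1r subrr mul0r addr0.
Qed.

End Projection.

(** * The subalgebra of invariants *)

Section Biderivation.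
Variables (K : comNzRingType) (R : comAlgType K) (I : Type) (s t : seq I).
Variables (p : I -> R) (x : I -> I -> R).

(** The sum in [pbrEw], with a free family [q] in place of the derivatives of the second
    argument. *)
Let B q := \sum_(i <- s) \sum_(j <- t) p i * q j * x i j.

Lemma bider_sumD q1 q2 : B (fun j => q1 j + q2 j) = B q1 + B q2.
Proof.
rewrite -big_split; apply: eq_bigr => i _; rewrite -big_split.
by apply: eq_bigr => j _; rewrite mulrDr mulrDl.
Qed.

Lemma bider_sumZ k q : B (fun j => k *: q j) = k *: B q.
Proof.
rewrite scaler_sumr; apply: eq_bigr => i _; rewrite scaler_sumr.
by apply: eq_bigr => j _; rewrite -scalerAr -scalerAl.
Qed.

Lemma bider_sumM q1 q2 y w :
  B (fun j => q1 j * w + y * q2 j) = B q1 * w + B q2 * y.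
Proof.
rewrite bider_sumD; congr (_ + _).
  rewrite mulr_suml; apply: eq_bigr => i _; rewrite mulr_suml.
  by apply: eq_bigr => j _; rewrite mulrA mulrAC.
rewrite mulr_suml; apply: eq_bigr => i _; rewrite mulr_suml.
by apply: eq_bigr => j _; rewrite [RHS]mulrC !mulrA [y * p i]mulrC.
Qed.

End Biderivation.

Section Subalgebra.
Variables (K : fieldType) (n : nat) (c : 'I_n -> 'I_n -> 'rV[K]_n).
Implicit Types (g h y w : SP K n).

Lemma pbr1r g : pbr c g 1 = 0.
Proof.
have d1 a : pderiv a (1 : SP K n) = 0.
  apply: etrans (pderivU a 1 mone) _; rewrite cm1 mulr0; exact: monalgU0.
by rewrite /pbr big1 // => a _; apply: big1 => b _; apply: mul3_eq0r.
Qed.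

Lemma pbrZr g k y : pbr c g (k *: y) = k *: pbr c g y.
Proof.
(* The two lists of variables can differ, for example when [k = 0]; both brackets are expanded over
   a common list. *)
pose t := undup (vars y ++ vars (k *: y)).
have t1 : {subset vars y <= t} by move=> a ya; rewrite mem_undup mem_cat ya.
have t2 : {subset vars (k *: y) <= t}.
  by move=> a ya; rewrite mem_undup mem_cat ya orbT.
have s1 : {subset vars g <= vars g} by [].
have ut : uniq t by exact: undup_uniq.
apply: etrans (pbrEw c (vars_uniq g) ut s1 t2) _.
apply: etrans _ (esym (congr1 ( *:%R k) (pbrEw c (vars_uniq g) ut s1 t1))).
apply: etrans _ (bider_sumZ (vars g) t (fun a => pderiv a g) (xbr c) k
  (fun b => pderiv b y)).
by apply: eq_bigr => a _; apply: eq_bigr => b _; rewrite pderivZ.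
Qed.

Lemma pbrDr g y w : pbr c g (y + w) = pbr c g y + pbr c g w.
Proof.
pose t := undup (vars y ++ vars w ++ vars (y + w)).
have t1 : {subset vars y <= t} by move=> a ya; rewrite mem_undup mem_cat ya.
have t2 : {subset vars w <= t}.
  by move=> a ya; rewrite mem_undup !mem_cat ya orbT.
have t3 : {subset vars (y + w) <= t}.
  by move=> a ya; rewrite mem_undup !mem_cat ya !orbT.
have s1 : {subset vars g <= vars g} by [].
have ut : uniq t by exact: undup_uniq.
apply: etrans (pbrEw c (vars_uniq g) ut s1 t3) _.
apply: etrans _ (esym (congr2 +%R (pbrEw c (vars_uniq g) ut s1 t1)
  (pbrEw c (vars_uniq g) ut s1 t2))).
apply: etrans _ (bider_sumD (vars g) t (fun a => pderiv a g) (xbr c)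
  (fun b => pderiv b y) (fun b => pderiv b w)).
apply: eq_bigr => a _; apply: eq_bigr => b _.
exact: (congr1 (fun q => pderiv a g * q * xbr c a b) (pderivD b y w)).
Qed.

Lemma pbrMr g y w : pbr c g (y * w) = pbr c g y * w + pbr c g w * y.
Proof.
pose t := undup (vars y ++ vars w ++ vars (y * w)).
have t1 : {subset vars y <= t} by move=> a ya; rewrite mem_undup mem_cat ya.
have t2 : {subset vars w <= t}.
  by move=> a ya; rewrite mem_undup !mem_cat ya orbT.
have t3 : {subset vars (y * w) <= t}.
  by move=> a ya; rewrite mem_undup !mem_cat ya !orbT.
have s1 : {subset vars g <= vars g} by [].
have ut : uniq t by exact: undup_uniq.
apply: etrans (pbrEw c (vars_uniq g) ut s1 t3) _.
apply: etrans _ (esym (congr2 (fun u v => u * w + v * y)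
  (pbrEw c (vars_uniq g) ut s1 t1) (pbrEw c (vars_uniq g) ut s1 t2))).
apply: etrans _ (bider_sumM (vars g) t (fun a => pderiv a g) (xbr c)
  (fun b => pderiv b y) (fun b => pderiv b w) y w).
apply: eq_bigr => a _; apply: eq_bigr => b _.
exact: (congr1 (fun q => pderiv a g * q * xbr c a b) (pderivM b y w)).
Qed.

Lemma in_ideal_scale (G A : SP K n -> Prop) k y :
  in_ideal (gen_alg G) A y -> in_ideal (gen_alg G) A (k *: y).
Proof.
elim=> [a r Aa Gr||u v _ ku _ kv].
- by rewrite scalerAr; apply: id_gen => //; apply: ga_scale.
- by rewrite scaler0; apply: id_zero.
by rewrite scalerDr; apply: id_add.
Qed.

Lemma in_ideal_mul (G A : SP K n -> Prop) y w :
  in_ideal (gen_alg G) A y -> gen_alg G w -> in_ideal (gen_alg G) A (y * w).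
Proof.
move=> Iy Gw; elim: Iy => [a r Aa Gr||u v _ Iu _ Iv].
- by rewrite -mulrA; apply: id_gen => //; apply: ga_mul.
- by rewrite mul0r; apply: id_zero.
by rewrite mulrDl; apply: id_add.
Qed.

Lemma gen_alg_mono (G1 G2 : SP K n -> Prop) y :
  (forall u, G1 u -> G2 u) -> gen_alg G1 y -> gen_alg G2 y.
Proof.
move=> G12; elim=> [u /G12|| a u _|u v _ Gu _|u v _ Gu _].
- exact: ga_gen.
- exact: ga_one.
- exact: ga_scale.
- exact: ga_add.
exact: ga_mul.
Qed.

(** The bracket with a fixed element is a derivation, and [S_plus] lies in the coefficient algebra
    [S_all] of the ideal, so both terms of the Leibniz rule stay in the ideal. *)
Lemma Zcal_subalgebra (Th : 'M[K]_n) (z : K) (m : nat) :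
  is_subalgebra (Zcal c Th z m).
Proof.
have sub y : S_plus Th z m y -> S_all Th z m y.
  by apply: gen_alg_mono => u [j [x [_ h]]]; exists j, x.
split.
- split=> [|xs _]; first exact: ga_one.
  by rewrite pbr1r; apply: id_zero.
- move=> a y [Sy Zy]; split=> [|xs nx]; first exact: ga_scale.
  by rewrite pbrZr; apply: in_ideal_scale; apply: Zy.
- move=> y w [Sy Zy] [Sw Zw]; split=> [|xs nx]; first exact: ga_add.
  by rewrite pbrDr; apply: id_add; [apply: Zy | apply: Zw].
move=> y w [Sy Zy] [Sw Zw]; split=> [|xs nx]; first exact: ga_mul.
rewrite pbrMr; apply: id_add; apply: in_ideal_mul.
- exact: Zy.
- exact: sub.
- exact: Zw.
exact: sub.
Qed.

End Subalgebra.

Theorem theorem2p2 (K : closedFieldType) (hchar : [pchar K] =i pred0)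
  (n : nat) (c : 'I_n -> 'I_n -> 'rV[K]_n) (Th : 'M[K]_n) (m : nat) (z : K) :
  is_lie_algebra c -> is_lie_aut c Th -> has_order Th m ->
  m.-primitive_root z ->
  (exists f : 'rV[K]_n, is_regular c f /\ in_q0star Th z m f) ->
  is_subalgebra (Zcal c Th z m) /\
  (forall Y1 Y2 : SP K n, Zcal c Th z m Y1 -> Zcal c Th z m Y2 -> pbr c Y1 Y2 = 0).
Proof.
move=> [c0 _] [_ ThM] [mgt0 [Thm _]] pz [f [reg f0]].
split=> [|Y1 Y2]; first exact: Zcal_subalgebra.
exact: (pbr_Zcal_eq0 c0 ThM Thm pz hchar reg (twisted_form_q0star Thm pz f0)).
Qed.
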